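(* Let $F$ be a field of characteristic zero, $A\subseteq M_n(F)$ a semisimple subalgebra containing the identity, and $\mathcal G$ the group of units of the centralizer of $A$ in $M_n(F)$. Then every polynomial map $f:M_n(F)^k\to M_n(F)$ satisfying $f(gx_1g^{-1},\dots,gx_kg^{-1})=g\,f(x_1,\dots,x_k)\,g^{-1}$ for all $g\in\mathcal G$ is given by a mixed $A$-trace polynomial, i.e. by a linear combination of products $\phi\cdot a_1x_{i_1}a_2\cdots a_mx_{i_m}a_{m+1}$ where $a_j\in A$ and $\phi$ is a polynomial in functions $tr(b_1x_{j_1}\cdots b_rx_{j_r})$ with $b_l\in A$. *)

(* Defs.v *)
From HB Require Import structures.
From mathcomp Require Import all_boot all_algebra.
Set Implicit Arguments. Unset Strict Implicit. Unset Printing Implicit Defensive.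
Import GRing.Theory.
Local Open Scope ring_scope.

Section Defs.
Variables (F : fieldType) (n k : nat).
Notation M := 'M[F]_n.

Definition is_unital_subalgebra (A : {pred M}) : Prop :=
  [/\ (1%:M : M) \in A,
      (forall a b, a \in A -> b \in A -> a + b \in A),
      (forall (c : F) a, a \in A -> c *: a \in A)
    & (forall a b, a \in A -> b \in A -> a * b \in A)].

Definition is_ideal (A I : {pred M}) : Prop :=
  [/\ (forall x, x \in I -> x \in A),
      (0 : M) \in I,
      (forall x y, x \in I -> y \in I -> x + y \in I),
      (forall (c : F) x, x \in I -> c *: x \in I)
    & (forall a x, a \in A -> x \in I -> a * x \in I /\ x * a \in I)].

Definition nilpotent_ideal (I : {pred M}) : Prop :=
  exists N : nat, (0 < N)%N /\
    forall s : seq M, size s = N -> all (fun x => x \in I) s -> \prod_(x <- s) x = 0.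

(* Semisimple (finite-dimensional) algebra: zero Jacobson radical, i.e.
   no nonzero nilpotent two-sided ideal. *)
Definition semisimple_alg (A : {pred M}) : Prop :=
  forall I : {pred M}, is_ideal A I -> nilpotent_ideal I -> forall x, x \in I -> x = 0.

Definition word_eval (w : seq (M * 'I_k)) (x : 'I_k -> M) : M :=
  \prod_(p <- w) (p.1 * x p.2).

Inductive polyfun : ((('I_k -> M) -> F) -> Prop) :=
  | pf_const (c : F) : polyfun (fun _ => c)
  | pf_entry (l : 'I_k) (i j : 'I_n) : polyfun (fun x => x l i j)
  | pf_add f g : polyfun f -> polyfun g -> polyfun (fun x => f x + g x)
  | pf_mul f g : polyfun f -> polyfun g -> polyfun (fun x => f x * g x).

Definition polynomial_map (f : ('I_k -> M) -> M) : Prop :=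
  forall i j : 'I_n, polyfun (fun x => f x i j).

Inductive A_trace_fun (A : {pred M}) : ((('I_k -> M) -> F) -> Prop) :=
  | tf_const (c : F) : A_trace_fun A (fun _ => c)
  | tf_tr (w : seq (M * 'I_k)) :
      all (fun p => p.1 \in A) w -> A_trace_fun A (fun x => \tr (word_eval w x))
  | tf_add f g : A_trace_fun A f -> A_trace_fun A g -> A_trace_fun A (fun x => f x + g x)
  | tf_mul f g : A_trace_fun A f -> A_trace_fun A g -> A_trace_fun A (fun x => f x * g x).

Inductive mixed_A_trace_poly (A : {pred M}) : ((('I_k -> M) -> M) -> Prop) :=
  | mt_term (phi : ('I_k -> M) -> F) (w : seq (M * 'I_k)) (a : M) :
      A_trace_fun A phi -> all (fun p => p.1 \in A) w -> a \in A ->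
      mixed_A_trace_poly A (fun x => phi x *: (word_eval w x * a))
  | mt_add f g : mixed_A_trace_poly A f -> mixed_A_trace_poly A g ->
      mixed_A_trace_poly A (fun x => f x + g x).

End Defs.

(* Main.v *)
Require Import Defs.
From HB Require Import structures.
From mathcomp Require Import all_boot all_fingroup all_algebra.
From mathcomp Require Import ring boolp.
Set Implicit Arguments. Unset Strict Implicit. Unset Printing Implicit Defensive.
Import GRing.Theory.
Local Open Scope ring_scope.

(** Polarizing the top-degree part of [f] (Ryser's formula) and pairing with one
    more matrix under the trace turns [f] into a tensor [T] on [V^(⊗D)] that
    commutes with [g^(⊗D)] for every unit [g] of the centralizer [C] of [A].
    By density and polarization, [T] commutes with the symmetric tensors of
    [C^(⊗D)], which form the commutant of the algebra spanned by [A^(⊗D)]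
    and the permutations of the factors. That algebra is its own double
    commutant: in characteristic zero the trace form of [A] is
    nondegenerate, so [A] has a separability idempotent, and averaging over
    it and over the permutations gives a projection onto the algebra that
    commutes with its left multiplications. Finally, the trace of a
    permutation times a decomposable tensor is a product of traces of words
    along the cycles, the cycle of the extra matrix giving the matrix-valued
    factor. *)

(** * Trace forms and separability of semisimple algebras *)

(** In a rank factorization [e = C *m D], cancelling the full-rank outer factors in [e * e = e]
    leaves [D *m C = 1], of size the rank; cyclicity of the trace concludes. *)
Lemma mxtrace_idempotent (F : fieldType) n (e : 'M[F]_n) :
  e * e = e -> \tr e = (\rank e)%:R.
Proof.
move=> ee; have eE := mulmx_base e.
move: (col_base_full e) (row_base_free e) eE.
move: (col_base e) (row_base e) => C D /row_fullP [L LE] /row_freeP [R RE] eE.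
suff DC : D *m C = 1%:M by rewrite -{1}eE mxtrace_mulC DC mxtrace1.
have : L *m ((C *m D) *m (C *m D)) *m R = L *m (C *m D) *m R.
  by rewrite eE; congr (L *m _ *m R).
by rewrite !mulmxA LE !mul1mx -!mulmxA RE !mulmx1.
Qed.

(* If [X] is not nilpotent, some polynomial in [X] without constant term is a
   nonzero idempotent, whose trace is its rank. *)
Lemma mxtrace_expr0_nilpotent (F : fieldType) n (X : 'M[F]_n) :
  [pchar F] =i pred0 -> (forall m, \tr (X ^+ m.+1) = 0) ->
  exists N, X ^+ N = 0.
Proof.
move=> /pcharf0P ch0; case: n X => [|n] X trX; first by exists 0%N; apply/matrixP => -[].
have [m [q]] := multiplicity_XsubC (char_poly X) 0.
rewrite polyC0 subr0 monic_neq0 ?char_poly_monic //= => q0 cE.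
(* The exponent is [m.+1], not [m], so that [e] below has no constant term even when 0 is not an
   eigenvalue of [X]. *)
have cop : coprimep q 'X^(m.+1).
  by rewrite coprimep_expr // -['X]subr0 -[0]polyC0 coprimep_XsubC.
have /Bezout_eq1_coprimepP [[u v] /= uv] := cop.
pose h := horner_mx X.
have hM p r : h (p * r) = h p * h r by exact: rmorphM.
have hD p r : h (p + r) = h p + h r by exact: rmorphD.
have h1 : h 1 = 1 by exact: rmorph1.
have h0 : h 0 = 0 by exact: rmorph0.
have hXn k : h 'X^k = X ^+ k by rewrite /h rmorphXn /= horner_mx_X.
have hX : h 'X = X by exact: horner_mx_X.
have hC c : h c%:P = c%:M by exact: horner_mx_C.
have qX0 : h q * X ^+ m = 0 by rewrite -hXn -hM -cE; exact: Cayley_Hamilton.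
have trC c (Y : 'M[F]_n.+1) : \tr (c%:M * Y) = c * \tr Y.
  by rewrite -mulmxE mul_scalar_mx mxtraceZ.
have tr0 p k : \tr (h p * X ^+ k.+1) = 0.
  elim/poly_ind: p k => [|p c IH] k; first by rewrite h0 mul0r mxtrace0.
  by rewrite hD hM hX hC mulrDl mxtraceD -mulrA -exprS IH add0r trC trX mulr0.
pose e := h (v * 'X^(m.+1)).
have e1 : h (u * q) + e = 1 by rewrite -hD uv.
have ee : e * e = e.
  rewrite -[RHS]mulr1 -e1 mulrDr; set w := e * h _; suff -> : w = 0 by rewrite add0r.
  rewrite /w /e -hM exprSr.
  have -> : v * ('X^m * 'X) * (u * q) = (v * 'X * u) * (q * 'X^m) by ring.
  by rewrite hM (hM q) hXn qX0 mulr0.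
have : \tr e = 0 by rewrite /e hM hXn tr0.
rewrite mxtrace_idempotent // => /eqP; rewrite ch0 mxrank_eq0 => /eqP e0.
by exists m; rewrite -[LHS]mul1r -e1 e0 addr0 hM -mulrA qX0 mulr0.
Qed.

(** A subspace inside [S] is enlarged by one vector of [S] at a time; its codimension bounds the
    number of steps. This makes dimension arguments available for algebras and ideals given as
    predicates. *)
Lemma closed_pred_vspace (F : fieldType) (vT : vectType F) (S : {pred vT}) :
  0 \in S -> (forall x y, x \in S -> y \in S -> x + y \in S) ->
  (forall c x, x \in S -> c *: x \in S) ->
  exists U : {vspace vT}, S =i U.
Proof.
move=> S0 SD SZ.
pose sub (U : {vspace vT}) := forall x, x \in U -> x \in S.
suff gen m : forall U, sub U -> (\dim {:vT} - \dim U <= m)%N -> exists U : {vspace vT}, S =i U.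
  apply: (gen (\dim {:vT}) 0%VS); last exact: leq_subr.
  by move=> x; rewrite memv0 => /eqP ->.
elim: m => [|m IH] U sU dU.
  exists U => x; apply/idP/idP; last exact: sU.
  have /eqP -> : U == fullv by rewrite eqEdim subvf -subn_eq0 -leqn0.
  by rewrite memvf.
have [[x xS xU]|nex] := pselect (exists2 x, x \in S & x \notin U); last first.
  exists U => x; apply/idP/idP; last exact: sU.
  by move=> xS; apply: contrapT => /negP xU; apply: nex; exists x.
apply: (IH (U + <[x]>)%VS).
  by move=> y /memv_addP [u uU [w /vlineP [c ->] ->]]; apply: SD; [exact: sU|exact: SZ].
rewrite -ltnS; apply: leq_trans dU; rewrite ltn_sub2l //.
  rewrite ltnNge; apply: contra xU => dU.
  by have /eqP -> : U == fullv; [rewrite eqEdim subvf|rewrite memvf].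
have := dimv_leqif_sup (addvSl U <[x]>); rewrite ltn_neqAle => -[-> ->].
by rewrite andbT subv_add subvv -memvE.
Qed.

(* For a nonzero [x] in [I], descend to a nonzero [w] in [I x] with [I w] = 0,
   since [I w = I x] would give [w = z w] with [z] nilpotent.  The elements
   killed by [I] form an ideal of square zero. *)
Lemma nil_ideal_eq0 (F : fieldType) n (A I : {pred 'M[F]_n}) :
  semisimple_alg A -> is_ideal A I ->
  (forall x, x \in I -> exists N, x ^+ N = 0) -> forall x, x \in I -> x = 0.
Proof.
move=> ssA idI nilI x0 x0I.
have [IA I0 ID IZ IM] := idI.
have [W WE] := closed_pred_vspace I0 ID IZ.
pose K := [pred x | (x \in I) && `[< forall y, y \in I -> y * x = 0 >]].
have KP u : reflect (u \in I /\ forall y, y \in I -> y * u = 0) (u \in K).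
  by apply: (iffP andP) => -[xI /asboolP].
have K0 : forall u, u \in K -> u = 0.
  apply: ssA; last first.
    exists 2%N; split=> // -[|u [|v []]] //= _; rewrite andbT => /andP [/KP [uI _] /KP [_]].
    by move=> /(_ _ uI) uv; rewrite big_cons big_seq1.
  split.
  - by move=> x /KP [/IA].
  - by apply/KP; split=> // y _; rewrite mulr0.
  - move=> u v /KP [uI u0] /KP [vI v0]; apply/KP; split=> [|y yI]; first exact: ID.
    by rewrite mulrDr u0 // v0 // addr0.
  - move=> c u /KP [uI u0]; apply/KP; split=> [|y yI]; first exact: IZ.
    by rewrite -mulmxE -scalemxAr mulmxE u0 // scaler0.
  - move=> a u aA /KP [uI u0]; have [au ua] := IM a u aA uI.
    split; apply/KP; split=> // y yI; last by rewrite mulrA u0 ?mul0r.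
    by rewrite mulrA u0 //; case: (IM a y aA yI).
pose L (x : 'M[F]_n) := (linfun (mulmxr x) @: W)%VS.
have LP x w : reflect (exists2 y, y \in I & w = y * x) (w \in L x).
  apply: (iffP memv_imgP) => -[y yW ->]; exists y; rewrite ?WE // -?WE // ?lfunE //.
suff gen d x : x \in I -> x != 0 -> (\dim (L x) <= d)%N -> exists2 w, w \in K & w != 0.
  apply: contrapT => /eqP x0n.
  by have [w /K0 -> /eqP] := gen _ x0 x0I x0n (leqnn _).
elim: d x => [|d IH] x xI xn0 dx.
  exists x => //; apply/KP; split=> // y yI.
  have : y * x \in L x by apply/LP; exists y.
  by move: dx; rewrite leqn0 dimv_eq0 => /eqP ->; rewrite memv0 => /eqP.
have [?|] := pselect (forall y, y \in I -> y * x = 0); first by exists x => //; apply/KP.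
move=> /existsNP [y /not_implyP [yI /eqP yx0]].
have wI : y * x \in I by case: (IM y x (IA _ yI) xI).
apply: (IH (y * x)) => //.
have sL : (L (y * x) <= L x)%VS.
  apply/subvP => _ /LP [z zI ->]; apply/LP; exists (z * y); last by rewrite mulrA.
  by case: (IM z y (IA _ zI) yI).
rewrite -ltnS; apply: leq_trans dx.
rewrite (ltn_leqif (dimv_leqif_sup sL)); apply/negP => /subvP sL'.
have /LP [z zI zE] : y * x \in L (y * x) by apply: sL'; apply/LP; exists y.
have [N zN] := nilI _ zI.
case/eqP: yx0; rewrite -[RHS](mul0r (y * x)) -zN.
by elim: (N) => [|k IHk]; rewrite ?expr0 ?mul1r // exprSr -mulrA -zE.
Qed.

Section Semisimple.
Variables (F : fieldType) (n : nat) (A : {pred 'M[F]_n}).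
Hypotheses (ch0 : [pchar F] =i pred0) (uA : is_unital_subalgebra A) (ssA : semisimple_alg A).
Notation M := 'M[F]_n.

Let A1 : (1 : M) \in A. Proof. by case: uA. Qed.
Let AD a b : a \in A -> b \in A -> a + b \in A. Proof. by case: uA => _ h _ _; exact: h. Qed.
Let AZ c a : a \in A -> c *: a \in A. Proof. by case: uA => _ _ h _; exact: h. Qed.
Let AM a b : a \in A -> b \in A -> a * b \in A. Proof. by case: uA => _ _ _; exact. Qed.
Let A0 : 0 \in A. Proof. by rewrite -(scale0r (1 : M)) AZ. Qed.
Let AX a m : a \in A -> a ^+ m \in A.
Proof. by move=> aA; elim: m => [|m IH]; rewrite ?expr0 // exprS AM. Qed.
Let Asum (J : finType) (G : J -> M) : (forall j, G j \in A) -> \sum_j G j \in A.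
Proof. by move=> GA; apply: (big_ind (fun x => x \in A)) => //; exact: AD. Qed.

(** The radical of the trace form is an ideal of [A]. All positive powers of its elements have trace
    zero, so it is a nil ideal and vanishes. *)
Lemma trace_form_nondegenerate x :
  x \in A -> (forall y, y \in A -> \tr (x * y) = 0) -> x = 0.
Proof.
move=> xA xt.
pose I := [pred x | (x \in A) && `[< forall y, y \in A -> \tr (x * y) = 0 >]].
have IP z : reflect (z \in A /\ forall y, y \in A -> \tr (z * y) = 0) (z \in I).
  by apply: (iffP andP) => -[zI /asboolP].
apply: (@nil_ideal_eq0 _ _ A I) => //; last by apply/IP.
  split.
  - by move=> z /IP [].
  - by apply/IP; split=> // y _; rewrite mul0r mxtrace0.
  - move=> u v /IP [uA' u0] /IP [vA v0]; apply/IP; split=> [|y yA]; first exact: AD.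
    by rewrite mulrDl mxtraceD u0 // v0 // addr0.
  - move=> c u /IP [uI u0]; apply/IP; split=> [|y yA]; first exact: AZ.
    by rewrite -mulmxE -scalemxAl mxtraceZ mulmxE u0 // mulr0.
  - move=> a u aA /IP [uI u0]; split; apply/IP; (split=> [|y yA]; first exact: AM).
      by rewrite -!mulmxE -mulmxA mxtrace_mulC -mulmxA !mulmxE u0 // AM.
    by rewrite -mulrA u0 // AM.
move=> z /IP [zA z0]; apply: mxtrace_expr0_nilpotent => // m.
by rewrite exprS z0 // AX.
Qed.

Lemma trace_dual_bases : exists m (b s : 'I_m -> M),
  [/\ forall i, b i \in A, forall i, s i \in A,
      forall x, x \in A -> x = \sum_j \tr (x * s j) *: b j
    & forall x, x \in A -> x = \sum_i \tr (b i * x) *: s i].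
Proof.
have [V VE] := closed_pred_vspace A0 AD AZ.
pose m := \dim V; pose b (i : 'I_m) := (vbasis V)`_i.
have bA i : b i \in A by rewrite VE vbasis_mem // mem_nth // size_tuple.
have bfree c : \sum_i c i *: b i = 0 -> forall i, c i = 0.
  by have /freeP := basis_free (vbasisP V); exact.
have bsp x : x \in A -> exists c, x = \sum_i c i *: b i.
  by rewrite VE => /coord_vbasis xE; exists (fun i => coord (vbasis V) i x).
(* The Gram matrix is invertible: a kernel vector gives an element of [A] orthogonal to [A]. Its
   inverse yields the dual basis [s]. *)
pose G : 'M[F]_m := \matrix_(i, j) \tr (b i * b j).
have GU : G \in unitmx.
  rewrite -row_free_unit -kermx_eq0; apply/eqP/row_matrixP => i; rewrite row0.
  move: (row i _) (row_sub i (kermx G)) => v /sub_kermxP vG.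
  apply/rowP => j; rewrite !mxE; move: j; apply: bfree; apply: trace_form_nondegenerate.
    by apply: Asum => i0; rewrite AZ.
  move=> _ /bsp [c ->]; rewrite mulr_sumr raddf_sum big1 //= => j _.
  rewrite -mulmxE -scalemxAr mxtraceZ mulmx_suml raddf_sum /=.
  move/rowP/(_ j): vG; rewrite mxE [X in _ = X]mxE => vGj.
  rewrite [X in _ * X](_ : _ = 0) ?mulr0 // -[RHS]vGj.
  by apply: eq_bigr => k _; rewrite -scalemxAl mxtraceZ mxE.
pose s j := \sum_k invmx G k j *: b k.
have sA j : s j \in A by apply: Asum => k; rewrite AZ.
have bs i j : \tr (b i * s j) = (i == j)%:R.
  have /matrixP/(_ i j) := mulmxV GU; rewrite !mxE => <-.
  rewrite mulr_sumr raddf_sum; apply: eq_bigr => k _ /=.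
  by rewrite -mulmxE -scalemxAr mxtraceZ mxE mulrC.
exists m, b, s; split=> // x xA.
  have [c xE] := bsp x xA; rewrite {1}xE; apply: eq_bigr => j _; congr (_ *: _).
  rewrite xE mulr_suml raddf_sum (bigD1 j) //= -mulmxE -scalemxAl mxtraceZ mulmxE bs eqxx mulr1.
  rewrite big1 ?addr0 // => i ij; rewrite -mulmxE -scalemxAl mxtraceZ mulmxE bs.
  by rewrite (negPf ij) mulr0.
apply/eqP; rewrite -subr_eq0; apply/eqP; apply: trace_form_nondegenerate.
  by rewrite -scaleN1r AD ?AZ ?Asum // => i; rewrite AZ.
move=> _ /bsp [c ->]; rewrite mulr_sumr raddf_sum big1 //= => j _.
rewrite -mulmxE -scalemxAr mxtraceZ mxtrace_mulC mulmxE mulrBr raddfB /=.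
have bsZ i d : \tr (b j * (d *: s i)) = d * (j == i)%:R.
  by rewrite -mulmxE -scalemxAr mxtraceZ mulmxE bs.
suff -> : \tr (b j * \sum_i \tr (b i * x) *: s i) = \tr (b j * x) by rewrite subrr mulr0.
rewrite mulr_sumr raddf_sum (bigD1 j) //= bsZ eqxx mulr1 big1 ?addr0 // => i ij.
by rewrite bsZ eq_sym (negPf ij) mulr0.
Qed.

(* [a] and [r] are dual bases for the trace form, [r] rescaled by the inverse of
   the Casimir element [z = \sum_i b i * s i]; [z] is invertible because
   [\tr (z * x)] is the trace of [x] on the regular representation of [A]. *)
Lemma separability_idempotent : exists m (a r : 'I_m -> M) (t : M -> 'I_m -> 'I_m -> F),
  [/\ forall i, a i \in A, forall i, r i \in A, \sum_i a i * r i = 1,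
      forall c, c \in A -> forall i, c * a i = \sum_j t c i j *: a j
    & forall c, c \in A -> forall j, r j * c = \sum_i t c i j *: r i].
Proof.
have [m [b [s [bA sA xb xs]]]] := trace_dual_bases.
pose t c i j := \tr (c * b i * s j).
have cb c i : c \in A -> c * b i = \sum_j t c i j *: b j by move=> cA; apply: xb; apply: AM.
have sc c j : c \in A -> s j * c = \sum_i t c i j *: s i.
  move=> cA; rewrite {1}(xs (s j * c)) ?AM //; apply: eq_bigr => i _; congr (_ *: _).
  by rewrite /t mulrA -mulmxE mxtrace_mulC mulmxA.
pose z := \sum_i b i * s i.
have zA : z \in A by apply: Asum => i; rewrite AM.
have zC c : c \in A -> c * z = z * c.
  move=> cA; rewrite mulr_sumr mulr_suml.
  under eq_bigr do rewrite mulrA cb // mulr_suml.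
  under [RHS]eq_bigr do rewrite -mulrA sc // mulr_sumr.
  rewrite exchange_big /=; apply: eq_bigr => j _; apply: eq_bigr => i _.
  by rewrite -!mulmxE -scalemxAl -scalemxAr.
(* As [z] is central in [A], its annihilator in [A] is an ideal; it remains to see that this ideal
   is nil. *)
have zinj x : x \in A -> z * x = 0 -> x = 0.
  move=> xA xz; pose I := [pred x | (x \in A) && (z * x == 0)].
  have IP y : reflect (y \in A /\ z * y = 0) (y \in I) by apply: (iffP andP) => -[? /eqP].
  apply: (@nil_ideal_eq0 _ _ A I) => //; last by apply/IP.
    split.
    - by move=> y /IP [].
    - by apply/IP; rewrite mulr0.
    - by move=> u v /IP [uI u0] /IP [vI v0]; apply/IP; rewrite AD // mulrDr u0 v0 addr0.
    - move=> c u /IP [uI u0]; apply/IP; rewrite AZ //; split=> //.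
      by rewrite -mulmxE -scalemxAr mulmxE u0 scaler0.
    - move=> c u cA /IP [uI u0]; split; apply/IP; rewrite AM //; split=> //.
        by rewrite mulrA -zC // -mulrA u0 mulr0.
      by rewrite mulrA u0 mul0r.
  move=> y /IP [yA zy].
  (* Left multiplication by [c] in the basis [b], with images as rows; hence products are reversed
     in [LmM]. *)
  pose Lm c : 'M[F]_m := \matrix_(i, j) t c i j.
  have LmM c d : c \in A -> d \in A -> Lm (c * d) = Lm d * Lm c.
    move=> cA dA; apply/matrixP => i j; rewrite !mxE /t -[c * d * b i]mulrA cb //.
    rewrite mulr_sumr mulr_suml raddf_sum; apply: eq_bigr => k _ /=.
    by rewrite -!mulmxE -scalemxAr -scalemxAl mxtraceZ !mxE.
  have LmX k : Lm (y ^+ k.+1) = Lm y ^+ k.+1.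
    by elim: k => [|k IH]; rewrite ?expr1 // exprS LmM ?AX // IH -exprSr.
  have [k] : exists k, Lm y ^+ k = 0.
    apply: mxtrace_expr0_nilpotent => // k; rewrite -LmX exprS.
    rewrite [LHS](_ : _ = \tr (z * (y * y ^+ k))); last first.
      rewrite -zC ?AM ?AX // mulr_sumr raddf_sum; apply: eq_bigr => i _ /=.
      by rewrite mxE /t mulrA.
    by rewrite mulrA zy mul0r mxtrace0.
  move=> Lk; exists k.+1.
  have {Lk} : Lm (y ^+ k.+1) = 0 by rewrite LmX exprS Lk mulr0.
  move/matrixP=> Lk; rewrite -[LHS]mulr1 (xb 1 A1) mulr_sumr big1 // => i _.
  rewrite -mulmxE -scalemxAr mulmxE cb ?AX // big1 ?scaler0 // => j _.
  by have := Lk i j; rewrite !mxE => ->; rewrite scale0r.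
(* Multiplication by [z] is injective on the finite-dimensional [A], hence onto. *)
have [w wA zw] : exists2 w, w \in A & z * w = 1.
  have [V VE] := closed_pred_vspace A0 AD AZ.
  pose f := linfun (mulmx z) : 'End(M).
  have fE x : f x = z * x by rewrite lfunE.
  suff : 1 \in (f @: V)%VS.
    by case/memv_imgP => w wV w1; exists w; rewrite ?VE // w1 fE.
  have sV : (f @: V <= V)%VS.
    by apply/subvP => _ /memv_imgP [x xV ->]; rewrite fE -VE AM // VE.
  have /eqP -> : (f @: V)%VS == V; last by rewrite -VE.
  rewrite eqEdim sV -(limg_ker_dim f V) (_ : (V :&: lker f)%VS = 0%VS) ?dimv0 ?add0n ?leqnn //.
  apply: subv_anti; rewrite sub0v andbT; apply/subvP => x; rewrite memv_cap memv_ker fE memv0 -VE.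
  by case/andP => xA /eqP/zinj ->.
have wC c : c \in A -> c * w = w * c.
  move=> cA; transitivity (w * (c * z) * w); first by rewrite zC // mulrA zC // zw mul1r.
  by rewrite mulrA -mulrA zw mulr1.
exists m, b, (fun i => s i * w), t; split=> //.
- by move=> i; rewrite AM.
- by rewrite -[RHS]zw mulr_suml; apply: eq_bigr => i _; rewrite mulrA.
- by move=> c cA i; rewrite cb.
- move=> c cA j; rewrite -mulrA -wC // mulrA sc // mulr_suml; apply: eq_bigr => i _.
  by rewrite -mulmxE -scalemxAl.
Qed.
End Semisimple.

(** * Polarization and tensor powers *)

(** Inclusion-exclusion, read off from expanding a product of factors [1 + c i] with [c i = 0] on
    [G] and [-1] off it. *)
Lemma sum_sign_supset (R : comNzRingType) (T : finType) (G : {set T}) :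
  \sum_(J : {set T} | G \subset J) (-1) ^+ #|~: J| = (G == setT)%:R :> R.
Proof.
pose c i : R := if i \in G then 0 else -1.
transitivity (\prod_i (1 + c i)).
  rewrite bigA_distr big_mkcond; apply: eq_bigr => J _.
  rewrite (bigID (mem J)) /= big1 ?mul1r => [|i ->] //.
  rewrite (eq_bigr c) => [|i /negPf -> //]; case: ifPn => [GJ|].
    rewrite (eq_bigr (fun=> -1)) => [|i iJ]; last first.
      by rewrite /c ifN //; apply: contra iJ => /(subsetP GJ).
    rewrite prodr_const; congr (_ ^+ _); apply: eq_card => i.
    by rewrite !inE.
  by case/subsetPn => i iG iJ; rewrite (bigD1 i) //= /c iG mul0r.
have [GT|] := eqVneq G setT; first by rewrite big1 // => i _; rewrite /c GT inE addr0.
rewrite -subTset => /subsetPn [i _ iG].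
by rewrite (bigD1 i) //= /c (negPf iG) subrr mul0r.
Qed.

(** The product expands over maps [g] with image in [J]; the signs over all such [J] cancel unless
    [g] is onto. For [e < d] nothing is left, and for [e = d] the permanent is. *)
Lemma ryser_surj (R : comNzRingType) d e (y : 'I_d -> 'I_e -> R) :
  \sum_(J : {set 'I_d}) (-1) ^+ #|~: J| * \prod_j \sum_(i in J) y i j =
  \sum_(g : {ffun 'I_e -> 'I_d} | g @: 'I_e == setT) \prod_j y (g j) j.
Proof.
transitivity (\sum_(J : {set 'I_d}) \sum_(g : {ffun 'I_e -> 'I_d} | g @: 'I_e \subset J)
    (-1) ^+ #|~: J| * \prod_j y (g j) j).
  apply: eq_bigr => J _; rewrite (bigA_distr_big (mem J)) mulr_sumr.
  apply: eq_bigl => g; apply/ffun_onP/subsetP => [gJ _ /imsetP [j _ ->] //|gJ j].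
  by apply: gJ; apply: imset_f.
rewrite (exchange_big_dep predT) //= [RHS]big_mkcond; apply: eq_bigr => g _.
by rewrite -mulr_suml sum_sign_supset; case: eqP; rewrite ?mul1r ?mul0r.
Qed.

Lemma ryser_lt (R : comNzRingType) d e (y : 'I_d -> 'I_e -> R) : (e < d)%N ->
  \sum_(J : {set 'I_d}) (-1) ^+ #|~: J| * \prod_j \sum_(i in J) y i j = 0.
Proof.
move=> ed; rewrite ryser_surj big_pred0 // => g; apply/negP => /eqP gT.
have := leq_imset_card g 'I_e; rewrite gT cardsT !card_ord leqNgt.
by rewrite ed.
Qed.

Lemma ryser_perm (R : comNzRingType) d (y : 'I_d -> 'I_d -> R) :
  \sum_(J : {set 'I_d}) (-1) ^+ #|~: J| * \prod_j \sum_(i in J) y i j =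
  \sum_(s : 'S_d) \prod_j y (s j) j.
Proof.
rewrite ryser_surj (reindex_onto (fun s : {perm 'I_d} => val s)
  (fun g => insubd (1%g : {perm 'I_d}) g)) /=; last first.
  move=> g /eqP gT; rewrite insubdK //; apply/injectiveP.
  have : #|g @: 'I_d| == #|'I_d| by rewrite gT cardsT.
  by move/imset_injP => gi i j; apply: gi.
apply: eq_big => [s|s _]; last by apply: eq_bigr => j _; rewrite -pvalE.
rewrite valKd eqxx andbT; apply/eqP/setP => i; rewrite inE; apply/imsetP.
by exists (s^-1%g i) => //; rewrite /= pvalE permKV.
Qed.

(** * Tensor powers of matrices in multi-index coordinates *)

Section Kron.
Variables (n D : nat).
Notation J := {ffun 'I_D -> 'I_n}.

Lemma sum_ffun_enum_val (R : nmodType) (G : J -> R) :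
  \sum_(i < #|{: J}|) G (enum_val i) = \sum_p G p.
Proof. by rewrite -(big_enum_val G). Qed.

(* Endomorphisms of [V^(⊗D)], in the basis of multi-indices [{ffun 'I_D -> 'I_n}]. *)
Definition ffun_mx (R : Type) (K : J -> J -> R) : 'M[R]_#|{: J}| :=
  \matrix_(i, j) K (enum_val i) (enum_val j).

Lemma eq_ffun_mx (R : Type) (K L : J -> J -> R) :
  (forall p q, K p q = L p q) -> ffun_mx K = ffun_mx L.
Proof. by move=> KL; apply/matrixP => i j; rewrite !mxE. Qed.

Lemma ffun_mxP (R : Type) (X : 'M[R]_#|{: J}|) :
  X = ffun_mx (fun p q => X (enum_rank p) (enum_rank q)).
Proof. by apply/matrixP => i j; rewrite mxE !enum_valK. Qed.

Lemma ffun_mxM (R : pzRingType) (K L : J -> J -> R) :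
  ffun_mx K * ffun_mx L = ffun_mx (fun p q => \sum_r K p r * L r q).
Proof.
apply/matrixP => i j; rewrite !mxE -sum_ffun_enum_val.
by apply: eq_bigr => k _; rewrite !mxE.
Qed.

Lemma mxtrace_ffun_mx (R : pzRingType) (K : J -> J -> R) : \tr (ffun_mx K) = \sum_p K p p.
Proof. by rewrite -sum_ffun_enum_val; apply: eq_bigr => i _; rewrite mxE. Qed.

Definition kron (R : comNzRingType) (x : 'I_D -> 'M[R]_n) : 'M[R]_#|{: J}| :=
  ffun_mx (fun p q => \prod_l x l (p l) (q l)).

Definition permop (R : comNzRingType) (s : 'S_D) : 'M[R]_#|{: J}| :=
  ffun_mx (fun p q => (q == [ffun l => p (s l)])%:R).

Lemma map_kron (R S : comNzRingType) (f : {rmorphism R -> S}) (x : 'I_D -> 'M[R]_n) :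
  map_mx f (kron x) = kron (fun l => map_mx f (x l)).
Proof.
by apply/matrixP => i j; rewrite !mxE rmorph_prod; apply: eq_bigr => l _; rewrite mxE.
Qed.

Section Ring.
Variable R : comNzRingType.
Implicit Types x y : 'I_D -> 'M[R]_n.

Lemma eq_kron x y : (forall l, x l = y l) -> kron x = kron y.
Proof. by move=> xy; apply: eq_ffun_mx => p q; apply: eq_bigr => l _; rewrite xy. Qed.

Lemma kronM x y : kron x * kron y = kron (fun l => x l * y l).
Proof.
rewrite ffun_mxM; apply: eq_ffun_mx => p q; under [RHS]eq_bigr do rewrite -mulmxE mxE.
by rewrite bigA_distr_bigA; apply: eq_bigr => r _; rewrite big_split.
Qed.

Lemma kron1 : kron (fun=> 1) = 1 :> 'M[R]_#|{: J}|.
Proof.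
apply/matrixP => i j; rewrite !mxE; under eq_bigr do rewrite !mxE.
have [->|ij] := eqVneq i j; first by rewrite big1 // => l _; rewrite eqxx.
have /existsP [l pql] : [exists l, enum_val i l != enum_val j l].
  apply: contraNT ij; rewrite negb_exists => /forallP h; apply/eqP/enum_val_inj/ffunP => l.
  by have := h l; rewrite negbK => /eqP.
by rewrite (bigD1 l) //= (negPf pql) mul0r.
Qed.

Lemma kron_sum (T : finType) (c : 'I_D -> T -> R) (y : 'I_D -> T -> 'M[R]_n) :
  kron (fun l => \sum_k c l k *: y l k) =
  \sum_(k : {ffun 'I_D -> T}) (\prod_l c l (k l)) *: kron (fun l => y l (k l)).
Proof.
apply/matrixP => i j; rewrite !mxE summxE.
under eq_bigr => l _ do [rewrite summxE; under eq_bigr do rewrite mxE].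
rewrite bigA_distr_bigA; apply: eq_bigr => k _.
by rewrite !mxE big_split.
Qed.

Lemma kron_sum1 (T : finType) (y : 'I_D -> T -> 'M[R]_n) :
  kron (fun l => \sum_k y l k) = \sum_(k : {ffun 'I_D -> T}) kron (fun l => y l (k l)).
Proof.
rewrite (eq_kron (y := fun l => \sum_k 1 *: y l k)) => [|l]; last first.
  by apply: eq_bigr => k _; rewrite scale1r.
by rewrite kron_sum; apply: eq_bigr => k _; rewrite big1 ?scale1r.
Qed.

(** Tensor products of matrix units are the matrix units of the tensor power, so linear statements
    need checking only on decomposable tensors. *)
Lemma ffun_mx_delta_sum (K : J -> J -> R) :
  ffun_mx K = \sum_p \sum_q K p q *: kron (fun l => delta_mx (p l) (q l)).
Proof.
apply/matrixP => i j; rewrite mxE summxE.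
have kE (p q : J) : (kron (fun l => delta_mx (p l) (q l))) i j =
    ((p == enum_val i) && (q == enum_val j))%:R :> R.
  rewrite mxE; under eq_bigr do rewrite mxE.
  have [/andP [/eqP -> /eqP ->]|] := boolP (_ && _).
    by rewrite big1 // => l _; rewrite !eqxx.
  move=> pq; have /existsP [l pql] :
      [exists l, (enum_val i l != p l) || (enum_val j l != q l)].
    apply: contraNT pq; rewrite negb_exists => /forallP h.
    have [iE jE] : enum_val i = p /\ enum_val j = q.
      by split; apply/ffunP => l; have := h l; rewrite negb_or !negbK => /andP [/eqP ? /eqP ?].
    by rewrite iE jE !eqxx.
  by rewrite (bigD1 l) //= -[_ && _]negbK negb_and pql mul0r.
rewrite (bigD1 (enum_val i)) //= summxE (bigD1 (enum_val j)) //= mxE kE !eqxx mulr1.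
rewrite big1 ?addr0 => [|q /negPf qj]; last by rewrite mxE kE qj andbF mulr0.
rewrite big1 ?addr0 // => p /negPf pi; rewrite summxE big1 // => q _.
by rewrite mxE kE pi mulr0.
Qed.

Lemma permopM_l s (K : J -> J -> R) :
  permop R s * ffun_mx K = ffun_mx (fun p q => K [ffun l => p (s l)] q).
Proof.
rewrite ffun_mxM; apply: eq_ffun_mx => p q; rewrite (bigD1 [ffun l => p (s l)]) //= eqxx mul1r.
by rewrite big1 ?addr0 // => r /negPf ->; rewrite mul0r.
Qed.

Lemma permopM_r s (K : J -> J -> R) :
  ffun_mx K * permop R s = ffun_mx (fun p q => K p [ffun l => q (s^-1%g l)]).
Proof.
have qE (q r : J) : (q == [ffun l => r (s l)]) = (r == [ffun l => q (s^-1%g l)]).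
  apply/eqP/eqP => ->; apply/ffunP => l; rewrite !ffunE ?permK ?permKV //.
rewrite ffun_mxM; apply: eq_ffun_mx => p q; rewrite (bigD1 [ffun l => q (s^-1%g l)]) //=.
rewrite qE eqxx mulr1 big1 ?addr0 // => r /negPf rq.
by rewrite qE rq mulr0.
Qed.

(** The order flips because a product of permutations applies its left factor first. *)
Lemma permopM s t : permop R s * permop R t = permop R (t * s)%g.
Proof.
rewrite permopM_l; apply: eq_ffun_mx => p q; congr (_ == _)%:R.
by apply/ffunP => l; rewrite !ffunE permM.
Qed.

Lemma permop1 : permop R 1 = 1.
Proof.
apply/matrixP => i j; rewrite !mxE eq_sym (_ : [ffun _ => _] = enum_val i) ?(inj_eq enum_val_inj) //.
by apply/ffunP => l; rewrite ffunE perm1.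
Qed.

Lemma permop_kron s x : permop R s * kron x = kron (fun l => x (s^-1%g l)) * permop R s.
Proof.
rewrite permopM_l permopM_r; apply: eq_ffun_mx => p q.
rewrite [RHS](reindex_inj (@perm_inj _ s)) /=; apply: eq_bigr => l _.
by rewrite !ffunE permK.
Qed.

Lemma mxtrace_kron_permop s x :
  \tr (kron x * permop R s) = \sum_(p : J) \prod_l x l (p l) (p (s^-1%g l)).
Proof.
rewrite permopM_r mxtrace_ffun_mx; apply: eq_bigr => p _.
by apply: eq_bigr => l _; rewrite ffunE.
Qed.

(** Ryser's formula entry by entry: symmetrized tensors are combinations of pure powers. *)
Lemma kron_polarization (c : 'I_D -> 'M[R]_n) :
  \sum_(I : {set 'I_D}) (-1) ^+ #|~: I| *: kron (fun=> \sum_(i in I) c i) =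
  \sum_(s : 'S_D) kron (fun l => c (s l)).
Proof.
apply/matrixP => i j; rewrite !summxE.
have := ryser_perm (fun k l => c k (enum_val i l) (enum_val j l)).
move=> h; transitivity (\sum_(s : 'S_D) \prod_l c (s l) (enum_val i l) (enum_val j l)).
  rewrite -h; apply: eq_bigr => I _; rewrite !mxE; congr (_ * _).
  by apply: eq_bigr => l _; rewrite summxE.
by apply: eq_bigr => s _; rewrite mxE.
Qed.

End Ring.
End Kron.
Arguments permop {n D} R s.

(** * The double commutant *)

Lemma poly_eval_eq0 (F : fieldType) (p : {poly F}) :
  [pchar F] =i pred0 -> (forall t, p.[t] = 0) -> p = 0.
Proof.
move=> /pcharf0P ch0 p0; apply/eqP; apply: contraT => pn0.
have := @max_poly_roots F p [seq i%:R | i <- iota 0 (size p)] pn0.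
rewrite size_map size_iota ltnn => h; apply: h.
  by apply/allP => _ /mapP [i _ ->]; apply/eqP.
rewrite map_inj_uniq ?iota_uniq // => i j ij.
wlog le_ij : i j ij / (i <= j)%N.
  by move=> w; have [/w|/ltnW/w] := leqP i j; [exact|move/(_ (esym ij))].
have := ch0 (j - i)%N; rewrite natrB // ij subrr eqxx => /esym.
by rewrite subn_eq0 => ji; apply/eqP; rewrite eqn_leq le_ij.
Qed.

(* The blocks of [P], as a map on columns, all commute with [S] iff [P]
   commutes with left multiplication by [S]. *)
Lemma left_linear_blocks (F : fieldType) N (P : 'End('M[F]_N)) (S : 'M[F]_N) :
  (forall b d, let K := \matrix_(a, c) P (delta_mx c d) a b in S * K = K * S) <->
  (forall X, P (S * X) = S * P X).
Proof.
have SK b d a c : (S * \matrix_(a, c) P (delta_mx c d) a b) a c = (S * P (delta_mx c d)) a b.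
  by rewrite !mxE; apply: eq_bigr => e _; rewrite mxE.
have KS b d a c : (\matrix_(a, c) P (delta_mx c d) a b * S) a c = P (S * delta_mx c d) a b.
  have -> : S * delta_mx c d = \sum_e S e c *: delta_mx e d.
    rewrite [LHS]matrix_sum_delta; apply: eq_bigr => e _.
    rewrite (bigD1 d) //= mxE (bigD1 c) //= mxE !eqxx mulr1 !big1 ?addr0 // => j jd.
      rewrite mxE big1 ?scale0r // => k _; rewrite mxE (negPf jd) andbF mulr0 //.
    by rewrite mxE (negPf jd) mulr0.
  rewrite linear_sum summxE mxE; apply: eq_bigr => e _.
  by rewrite linearZ !mxE mulrC.
split=> [h X|h b d]; last by apply/matrixP => a c; rewrite SK KS h.
have hd c d : P (S * delta_mx c d) = S * P (delta_mx c d).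
  by apply/matrixP => a b; rewrite -KS -SK h.
pose Q Y := P (S * Y) = S * P Y.
have Q0 : Q 0 by rewrite /Q mulr0 linear0 mulr0.
have QD Y Z : Q Y -> Q Z -> Q (Y + Z) by rewrite /Q mulrDr !linearD /= mulrDr => -> ->.
rewrite -/(Q X) (matrix_sum_delta X); apply: (big_ind Q) => // i _.
by apply: (big_ind Q) => // j _; rewrite /Q -mulmxE -scalemxAr !linearZ /= mulmxE hd.
Qed.

Section DoubleCentralizer.
Variables (F : fieldType) (n D : nat) (A : {pred 'M[F]_n}).
Hypotheses (ch0 : [pchar F] =i pred0) (uA : is_unital_subalgebra A) (ssA : semisimple_alg A).
Notation M := 'M[F]_n.
Notation J := {ffun 'I_D -> 'I_n}.
Notation MM := 'M[F]_#|{: J}|.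

(* The linear span of [A^(⊗D)] times the permutations of the factors. *)
Inductive twisted_span : MM -> Prop :=
  | twisted_span0 : twisted_span 0
  | twisted_spanD c a s X : (forall l, a l \in A) -> twisted_span X ->
      twisted_span (c *: (kron a * permop F s) + X).

Lemma twisted_span_kron a s : (forall l, a l \in A) -> twisted_span (kron a * permop F s).
Proof. move=> aA; rewrite -[X in twisted_span X]addr0 -[X in X + 0]scale1r.
exact/twisted_spanD/twisted_span0. Qed.

Lemma twisted_span_add X Y : twisted_span X -> twisted_span Y -> twisted_span (X + Y).
Proof. by elim=> [|c a s Z aA _ IH] YB; rewrite ?add0r // -addrA; constructor; auto. Qed.

Lemma twisted_span_scale c X : twisted_span X -> twisted_span (c *: X).
Proof.
elim=> [|d a s Z aA _ IH]; first by rewrite scaler0; constructor.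
by rewrite scalerDr scalerA; apply: twisted_spanD.
Qed.

Lemma twisted_span_sum (T : finType) (G : T -> MM) :
  (forall t, twisted_span (G t)) -> twisted_span (\sum_t G t).
Proof.
by move=> GB; apply: (big_ind twisted_span) => //; [constructor|exact: twisted_span_add].
Qed.

Lemma twisted_span_mull a s X : (forall l, a l \in A) -> twisted_span X ->
  twisted_span (permop F s * kron a * X).
Proof.
have [_ _ _ AM] := uA.
move=> aA; elim=> [|d b t Z bA _ IH]; first by rewrite mulr0; constructor.
rewrite mulrDr; apply: twisted_span_add => //.
rewrite -mulmxE -scalemxAr mulmxE; apply: twisted_span_scale.
rewrite mulrA -[_ * kron b]mulrA kronM permop_kron -mulrA permopM.
by apply: twisted_span_kron => l; apply: AM.
Qed.

Variable T : MM.
Hypothesis Tcomm : forall g : M, g \in unitmx -> (forall a, a \in A -> g * a = a * g) ->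
  kron (fun=> g) * T = T * kron (fun=> g).

(** Density of the units: for [y = c + 'X], each entry of the commutator [P] times [\det y] vanishes
    at every [t], either because [c + t] is a unit or because its determinant is zero. As [\det y]
    is a nonzero polynomial, [P = 0]; then [t = 0]. *)
Lemma kron_centralizer_comm c : (forall a, a \in A -> c * a = a * c) ->
  kron (fun=> c) * T = T * kron (fun=> c).
Proof.
move=> cA.
pose y : 'M[{poly F}]_n := map_mx polyC c + 'X%:M.
pose Y := map_mx polyC T.
pose P := kron (fun=> y) * Y - Y * kron (fun=> y).
have yE t : map_mx (horner_eval t) y = c + t%:M.
  by apply/matrixP => i j; rewrite !mxE /horner_eval hornerD hornerC hornerMn hornerX.
have ev t : map_mx (horner_eval t) P =
    kron (fun=> c + t%:M) * T - T * kron (fun=> c + t%:M).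
  have TE : map_mx (horner_eval t) Y = T.
    by apply/matrixP => i j; rewrite !mxE /horner_eval hornerC.
  by rewrite map_mxB -!mulmxE !map_mxM /= map_kron TE yE.
have dn0 : \det y != 0.
  have -> : \det y = char_poly (- c); last exact/monic_neq0/char_poly_monic.
  by rewrite /char_poly /char_poly_mx map_mxN opprK addrC.
have P0 : P = 0.
  apply/matrixP => i j; rewrite [RHS]mxE; apply/eqP.
  rewrite -[_ == 0]orbF -(negPf dn0) -mulf_eq0; apply/eqP; apply: poly_eval_eq0 => // t.
  have [gU|gNU] := boolP (c + t%:M \in unitmx).
    have := ev t; rewrite Tcomm ?subrr => [|//|a aA]; last first.
      by rewrite mulrDl mulrDr cA // -!mulmxE scalar_mxC.
    move/matrixP/(_ i j); rewrite [LHS]mxE [RHS]mxE /horner_eval hornerM => ->.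
    by rewrite mul0r.
  rewrite hornerM [X in _ * X](_ : _ = 0) ?mulr0 //.
  move: gNU; rewrite unitmxE unitfE negbK => /eqP <-.
  by rewrite -yE det_map_mx.
have := ev 0; rewrite P0 map_mx0 => /esym/eqP; rewrite subr_eq0 => /eqP.
by rewrite (eq_kron (y := fun=> c)) // => _; rewrite raddf0 addr0.
Qed.

Lemma sym_kron_comm (c : 'I_D -> M) : (forall l a, a \in A -> c l * a = a * c l) ->
  (\sum_(s : 'S_D) kron (fun l => c (s l))) * T = T * \sum_(s : 'S_D) kron (fun l => c (s l)).
Proof.
move=> cA; rewrite -kron_polarization mulr_suml mulr_sumr; apply: eq_bigr => I _.
rewrite -!mulmxE -scalemxAl -scalemxAr !mulmxE kron_centralizer_comm // => a aA.
by rewrite mulr_suml mulr_sumr; apply: eq_bigr => i _; rewrite cA.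
Qed.

Let fact_neq0 : (D`!%:R : F) != 0.
Proof. by move/pcharf0P: ch0 => ->; rewrite -lt0n fact_gt0. Qed.

Lemma kron_dual_sum m (a r : 'I_m -> M) : \sum_i a i * r i = 1 ->
  \sum_(k : {ffun 'I_D -> 'I_m}) kron (fun l => a (k l)) * kron (fun l => r (k l)) = 1.
Proof.
move=> ar; rewrite -(kron1 n D F) -ar kron_sum1; apply: eq_bigr => k _.
by rewrite kronM.
Qed.

(** Averaging over the separability idempotent in each slot and over the permutations fixes [K] up
    to the factor [D!], and turns it into a combination of symmetrized tensors of elements
    centralizing [A]. *)
Lemma commutant_comm (K : MM) :
  (forall a, (forall l, a l \in A) -> kron a * K = K * kron a) ->
  (forall s, permop F s * K = K * permop F s) -> T * K = K * T.
Proof.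
move=> Ka Ks.
have [m [a [r [t [aA rA ar ta tr]]]]] := separability_idempotent ch0 uA ssA.
(* The projection of the matrix algebra onto the centralizer of [A]. *)
pose avg Y := \sum_k a k * Y * r k.
have avgC Y c : c \in A -> avg Y * c = c * avg Y.
  move=> cA; rewrite mulr_suml mulr_sumr.
  under eq_bigr do rewrite -mulrA tr // mulr_sumr.
  under [RHS]eq_bigr do rewrite !mulrA ta // !mulr_suml.
  rewrite exchange_big; apply: eq_bigr => i _; apply: eq_bigr => j _.
  by rewrite -!mulmxE -!scalemxAl -!scalemxAr.
have kron_avg (y : 'I_D -> M) : kron (fun l => avg (y l)) =
    \sum_(k : {ffun 'I_D -> 'I_m}) kron (fun l => a (k l)) * kron y * kron (fun l => r (k l)).
  by rewrite kron_sum1; apply: eq_bigr => k _; rewrite !kronM.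
have kron_ar := kron_dual_sum ar.
have Kavg : K = \sum_(p : J) \sum_(q : J) K (enum_rank p) (enum_rank q) *:
    kron (fun l => avg (delta_mx (p l) (q l))).
  have {1}-> : K = \sum_(k : {ffun 'I_D -> 'I_m})
      kron (fun l => a (k l)) * K * kron (fun l => r (k l)).
    rewrite -{1}[K]mul1r -kron_ar mulr_suml; apply: eq_bigr => k _.
    by rewrite -!mulrA Ka.
  under eq_bigr => k _ do [rewrite {1}(ffun_mxP K) ffun_mx_delta_sum mulr_sumr mulr_suml].
  rewrite exchange_big; apply: eq_bigr => p _ /=.
  under eq_bigr => k _ do [rewrite mulr_sumr mulr_suml].
  rewrite exchange_big; apply: eq_bigr => q _ /=.
  rewrite kron_avg scaler_sumr; apply: eq_bigr => k _.
  by rewrite -!mulmxE -scalemxAr -scalemxAl.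
have Ksym : D`!%:R *: K = \sum_(p : J) \sum_(q : J) K (enum_rank p) (enum_rank q) *:
    \sum_(s : 'S_D) kron (fun l => avg (delta_mx (p (s l)) (q (s l)))).
  transitivity (\sum_(s : 'S_D) permop F s * K * permop F s^-1).
    rewrite (eq_bigr (fun=> K)) => [|s _]; last first.
      by rewrite Ks -mulrA permopM mulVg permop1 mulr1.
    by rewrite sumr_const card_Sn scaler_nat.
  rewrite (reindex_inj invg_inj) /=.
  rewrite {1}Kavg; under eq_bigr do rewrite mulr_sumr mulr_suml.
  rewrite exchange_big; apply: eq_bigr => p _ /=.
  under eq_bigr do rewrite mulr_sumr mulr_suml.
  rewrite exchange_big; apply: eq_bigr => q _ /=.
  rewrite scaler_sumr; apply: eq_bigr => s _.
  rewrite -!mulmxE -scalemxAr -scalemxAl !mulmxE permop_kron -mulrA permopM mulVg permop1 mulr1.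
  by rewrite invgK.
have -> : K = (D`!%:R)^-1 *: (D`!%:R *: K) by rewrite scalerA mulVf ?scale1r.
rewrite Ksym -!mulmxE -scalemxAr -scalemxAl !mulmxE; congr (_ *: _).
rewrite mulr_suml mulr_sumr; apply: eq_bigr => p _.
rewrite mulr_suml mulr_sumr; apply: eq_bigr => q _.
rewrite -!mulmxE -scalemxAr -scalemxAl !mulmxE; congr (_ *: _).
apply/esym/(@sym_kron_comm (fun l => avg (delta_mx (p l) (q l)))) => l c.
exact: avgC.
Qed.

(* The projection onto the twisted span, averaged over the symmetric group and
   the separability idempotent, commutes with left multiplication by that span,
   so its blocks commute with [T]; evaluate at [1]. *)
Lemma twisted_span_double_centralizer : twisted_span T.
Proof.
have [m [a [r [t [aA rA ar ta tr]]]]] := separability_idempotent ch0 uA ssA.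
have [V VE] : exists V : {vspace MM}, [pred X | `[< twisted_span X >]] =i V.
  apply: closed_pred_vspace.
  - exact/asboolP/twisted_span0.
  - by move=> X Y /asboolP XB /asboolP YB; apply/asboolP/twisted_span_add.
  - by move=> c X /asboolP XB; apply/asboolP/twisted_span_scale.
have VP X : reflect (twisted_span X) (X \in V).
  by rewrite -VE; apply: asboolP.
pose ka (k : {ffun 'I_D -> 'I_m}) : MM := kron (fun l => a (k l)).
pose kr (k : {ffun 'I_D -> 'I_m}) : MM := kron (fun l => r (k l)).
pose Q s k : 'End(MM) :=
  (linfun (mulmx (permop F s * ka k)) \o projv V \o linfun (mulmx (kr k * permop F s^-1)))%VF.
pose P : 'End(MM) := \sum_(s : 'S_D) \sum_k Q s k.
have PE X : P X = \sum_(s : 'S_D) \sum_k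
    permop F s * ka k * projv V (kr k * permop F s^-1 * X).
  rewrite sum_lfunE; apply: eq_bigr => s _; rewrite sum_lfunE; apply: eq_bigr => k _.
  by rewrite !comp_lfunE !lfunE.
have PV X : twisted_span (P X).
  rewrite PE; do 2!apply: twisted_span_sum => ?.
  by apply: twisted_span_mull => //; apply/VP/memv_proj.
have Pperm s X : P (permop F s * X) = permop F s * P X.
  rewrite !PE mulr_sumr (reindex_inj (mulIg s)) /=; apply: eq_bigr => u _.
  rewrite mulr_sumr; apply: eq_bigr => k _.
  by rewrite invMg -!permopM -!mulrA [permop F s^-1 * _]mulrA permopM mulgV permop1 mul1r.
have Pkron c X : (forall l, c l \in A) -> P (kron c * X) = kron c * P X.
  move=> cA; rewrite !PE mulr_sumr; apply: eq_bigr => s _.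
  pose c' l := c (s l); have c'A l : c' l \in A by exact: cA.
  have sc : permop F s^-1 * kron c = kron c' * permop F s^-1.
    by rewrite permop_kron; congr (_ * _); apply: eq_kron => l; rewrite invgK.
  have cs : kron c * permop F s = permop F s * kron c'.
    by rewrite permop_kron; congr (_ * _); apply: eq_kron => l; rewrite /c' permKV.
  (* The same coefficients give the right action on [kr] and the left action on [ka], so [kron c']
     passes from one side of the projection to the other. *)
  pose w (i k : {ffun 'I_D -> 'I_m}) := \prod_l t (c' l) (i l) (k l).
  have rc k : kr k * kron c' = \sum_i w i k *: kr i.
    rewrite kronM -(kron_sum (fun l i => t (c' l) i (k l)) (fun=> r)).
    by apply: eq_kron => l; rewrite tr.
  have ca i : kron c' * ka i = \sum_k w i k *: ka k.
    rewrite kronM -(kron_sum (fun l k => t (c' l) (i l) k) (fun=> a)).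
    by apply: eq_kron => l; rewrite ta.
  rewrite mulr_sumr.
  transitivity (\sum_k \sum_i w i k *: (permop F s * ka k * projv V (kr i * permop F s^-1 * X))).
    apply: eq_bigr => k _.
    rewrite -!mulrA [permop F s^-1 * _]mulrA sc -!mulrA [kr k * _]mulrA rc mulr_suml.
    rewrite linear_sum !mulr_sumr; apply: eq_bigr => i _.
    by rewrite -!mulmxE -scalemxAl linearZ /= -!scalemxAr !mulmxA.
  rewrite exchange_big; apply: eq_bigr => i _ /=.
  rewrite !mulrA cs -!mulrA [kron c' * _]mulrA ca mulr_suml mulr_sumr.
  by apply: eq_bigr => k _; rewrite -!mulmxE -scalemxAl -scalemxAr !mulmxA.
(* Each [kr k * permop F s^-1] already lies in [V], so [projv V] fixes it and every [s] contributes
   1. *)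
have P1 : P 1 = (D`!%:R : F) *: (1 : MM).
  rewrite PE (eq_bigr (fun=> 1)) => [|s _]; last first.
    rewrite (eq_bigr (fun k => permop F s * (ka k * kr k) * permop F s^-1)) => [|k _]; last first.
      rewrite mulr1 projv_id ?mulrA //; apply/VP/twisted_span_kron => l; exact: rA.
    by rewrite -mulr_suml -mulr_sumr (kron_dual_sum ar) mulr1 permopM mulVg permop1.
  by rewrite sumr_const card_Sn scaler_nat.
have PT : P (T * 1) = T * P 1.
  apply: (proj1 (left_linear_blocks P T)) => b d; apply: commutant_comm.
    move=> c cA; apply: (proj2 (left_linear_blocks P (kron c))) => X; exact: Pkron.
  move=> s; apply: (proj2 (left_linear_blocks P (permop F s))) => X; exact: Pperm.
have -> : T = (D`!%:R)^-1 *: P T.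
  rewrite -[T in P T]mulr1 PT P1 -!mulmxE -scalemxAr scalerA mulVf // scale1r.
  by rewrite mulmxE mulr1.
exact/twisted_span_scale/PV.
Qed.

End DoubleCentralizer.

(** * Cycles and trace monomials *)

Lemma mxtrace_mul_eq0 (F : fieldType) n (X : 'M[F]_n) :
  (forall Y, \tr (Y * X) = 0) -> X = 0.
Proof.
move=> h; apply/matrixP => i j; have := h (delta_mx j i).
rewrite /mxtrace (bigD1 j) //= big1 => [|k kj]; last first.
  by rewrite mxE big1 // => l _; rewrite mxE (negPf kj) mul0r.
rewrite mxE (bigD1 i) //= big1 => [|l li]; last by rewrite mxE (negPf li) andbF mul0r.
by rewrite !addr0 !mxE !eqxx mul1r => ->.
Qed.

Section CycleContraction.
Variables (R : comNzRingType) (n D : nat).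
Notation J := {ffun 'I_D -> 'I_n}.

(** The trace of [kron Z * permop R s^-1], that is, the product over the cycles of [s] of the traces
    of the [Z l] multiplied along the cycle. *)
Definition cycle_sum (Z : 'I_D -> 'M[R]_n) (s : 'S_D) : R :=
  \sum_(p : J) \prod_l Z l (p l) (p (s l)).

Lemma cycle_sum1 Z : cycle_sum Z 1 = \prod_l \tr (Z l).
Proof.
rewrite /cycle_sum /mxtrace bigA_distr_bigA; apply: eq_bigr => p _.
by apply: eq_bigr => l _; rewrite perm1.
Qed.

Lemma sum_ffun_update (G : J -> R) (t : 'I_D) :
  \sum_(p : J) \sum_c G [ffun l => if l == t then c else p l] = \sum_p G p *+ n.
Proof.
transitivity (\sum_(p : J) \sum_(c : 'I_n) G p); last first.
  by apply: eq_bigr => p _; rewrite sumr_const card_ord.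
(* Exchanging the free index [c] with the value [p t] is an involution on pairs. *)
pose h (pc : J * 'I_n) : J * 'I_n := ([ffun l => if l == t then pc.2 else pc.1 l], pc.1 t).
have hK : involutive h.
  move=> [p c]; rewrite /h /= ffunE eqxx; congr (_, _); apply/ffunP => l.
  by rewrite !ffunE; case: eqP => // ->.
rewrite !pair_big /= [RHS](reindex_inj (inv_inj hK)) /=.
exact: eq_bigr.
Qed.

(* Slot [t] is merged into its predecessor [s^-1 t] and replaced by a fixed
   point carrying the identity, whose trace accounts for the factor [n]. *)
Lemma cycle_sum_merge (Z : 'I_D -> 'M[R]_n) (s : 'S_D) (t : 'I_D) : s t != t ->
  cycle_sum Z s *+ n =
  cycle_sum (fun l => if l == t then 1 else if l == s^-1%g t then Z l * Z t else Z l)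
    (s * tperm t (s t))%g.
Proof.
move=> st; set u := s^-1%g t.
have su : s u = t by rewrite permKV.
have ut : u != t by apply: contra st => /eqP {1}<-; rewrite su.
rewrite /cycle_sum -sumrMnl -(sum_ffun_update _ t); apply: eq_bigr => p _.
rewrite (bigD1 t) //= (bigD1 u) //= eqxx (negPf ut) eqxx !permM su tpermL tpermR mxE eqxx mul1r.
rewrite -mulmxE mxE mulr_suml; apply: eq_bigr => c _.
rewrite (bigD1 t) //= (bigD1 u) //= !ffunE eqxx (negPf st) (negPf ut) su eqxx.
rewrite mulrA [X in X * _ = _]mulrC; congr (_ * _ * _).
apply: eq_bigr => l /andP [lt lu]; rewrite !ffunE (negPf lt) (negPf lu) permM.
have slt : s l != t by rewrite -su (inj_eq perm_inj).
rewrite (negPf slt) tpermD // eq_sym //.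
by rewrite (inj_eq perm_inj).
Qed.

End CycleContraction.

(** * From the twisted span to mixed trace polynomials *)

Section Mixed.
Variables (F : fieldType) (n k : nat) (A : {pred 'M[F]_n}).
Hypotheses (ch0 : [pchar F] =i pred0) (n0 : (0 < n)%N) (uA : is_unital_subalgebra A).
Hypothesis ssA : semisimple_alg A.
Notation M := 'M[F]_n.
Notation vars := ('I_k -> M).

Let A1 : (1 : M) \in A. Proof. by case: uA. Qed.
Let AM a b : a \in A -> b \in A -> a * b \in A. Proof. by case: uA => _ _ _; exact. Qed.

Lemma mixed_ext (f g : vars -> M) :
  (forall x, f x = g x) -> mixed_A_trace_poly A f -> mixed_A_trace_poly A g.
Proof. by move=> /funext ->. Qed.

Lemma trace_fun_ext (f g : vars -> F) :
  (forall x, f x = g x) -> A_trace_fun A f -> A_trace_fun A g.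
Proof. by move=> /funext ->. Qed.

Lemma mixed0 : mixed_A_trace_poly A (fun _ : vars => 0).
Proof.
apply: (@mixed_ext (fun x => 0 *: (word_eval [::] x * 1))) => [x|]; first by rewrite scale0r.
by apply: mt_term => //; constructor.
Qed.

Lemma mixed_scale c (f : vars -> M) :
  mixed_A_trace_poly A f -> mixed_A_trace_poly A (fun x => c *: f x).
Proof.
elim=> [phi w a phiA wA aA|g h _ IHg _ IHh].
  apply: (@mixed_ext (fun x => (c * phi x) *: (word_eval w x * a))) => [x|].
    by rewrite scalerA.
  by apply: mt_term => //; apply: tf_mul => //; constructor.
apply: mixed_ext (mt_add IHg IHh) => x; by rewrite scalerDr.
Qed.

Lemma mixed_sum (T : Type) (r : seq T) (f : T -> vars -> M) :
  (forall t, mixed_A_trace_poly A (f t)) -> mixed_A_trace_poly A (fun x => \sum_(t <- r) f t x).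
Proof.
move=> fA; elim: r => [|t r IH].
  by apply: mixed_ext mixed0 => x; rewrite big_nil.
by apply: mixed_ext (mt_add (fA t) IH) => x; rewrite big_cons.
Qed.

(** The matrix factor of a mixed term; the trailing coefficient [a] lets constants count as
    monomials and gives closure under products. *)
Definition A_monomial (y : vars -> M) : Prop := exists w a,
  [/\ all (fun p => p.1 \in A) w, a \in A & forall x, y x = word_eval w x * a].

Lemma A_monomial_const a : a \in A -> A_monomial (fun=> a).
Proof. by move=> aA; exists [::], a; split=> // x; rewrite /word_eval big_nil mul1r. Qed.

Lemma A_monomial_var i a : a \in A -> A_monomial (fun x => x i * a).
Proof.
move=> aA; exists [:: (1, i)], a; split=> //=; first by rewrite A1.
by move=> x; rewrite /word_eval big_seq1 mul1r.
Qed.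

Lemma A_monomial_mul y z : A_monomial y -> A_monomial z -> A_monomial (fun x => y x * z x).
Proof.
move=> [w [a [wA aA yE]]] [v [b [vA bA zE]]].
case: v vA zE => [|[c i] v] /= vA zE.
  exists w, (a * b); split=> // [|x]; first exact: AM.
  by rewrite yE zE /word_eval big_nil mul1r mulrA.
move: vA => /andP [cA vA].
exists (w ++ (a * c, i) :: v), b; split=> // [|x].
  by rewrite all_cat wA /= AM.
by rewrite yE zE /word_eval big_cat !big_cons /= !mulrA.
Qed.

(** Cyclicity moves the trailing coefficient in front of the first letter; with no letter the trace
    is a constant. *)
Lemma trace_fun_A_monomial y : A_monomial y -> A_trace_fun A (fun x => \tr (y x)).
Proof.
move=> [w [a [wA aA yE]]]; case: w wA yE => [|[c i] w] /= wA yE.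
  apply: trace_fun_ext (tf_const _ A (\tr a)) => x.
  by rewrite yE /word_eval big_nil mul1r.
move: wA => /andP [cA wA].
have h : all (fun p => p.1 \in A) ((a * c, i) :: w) by rewrite /= AM.
apply: trace_fun_ext (tf_tr h) => x; rewrite yE /word_eval !big_cons /= -!mulrA.
by rewrite -[in RHS]mulmxE mxtrace_mulC mulmxE -!mulrA.
Qed.

Lemma trace_fun_prod (T : Type) (r : seq T) (P : pred T) (f : T -> vars -> F) :
  (forall t, A_trace_fun A (f t)) -> A_trace_fun A (fun x => \prod_(t <- r | P t) f t x).
Proof.
move=> fA; elim: r => [|t r IH].
  by apply: trace_fun_ext (tf_const _ A 1) => x; rewrite big_nil.
case Pt : (P t); last by apply: trace_fun_ext IH => x; rewrite big_cons Pt.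
by apply: trace_fun_ext (tf_mul (fA t) IH) => x; rewrite big_cons Pt.
Qed.

(** Induction on the number of points moved by [s]: a moved slot other than 0 is merged into its
    predecessor. Slot 0 is never merged away and only grows on the right, so [m] stays in front. *)
Lemma cycle_sum_mixed D (s : 'S_D.+1) (Y : 'I_D.+1 -> vars -> M) :
  (forall l, A_monomial (Y l)) ->
  exists phi y, [/\ A_trace_fun A phi, A_monomial y &
    forall x m, cycle_sum (fun l => if l == ord0 then m * Y l x else Y l x) s
      = phi x * \tr (m * y x)].
Proof.
have [N] := ubnP #|[set l | s l != l]|; elim: N s Y => // N IH s Y sN Ymon.
have [s1|] := pselect (forall t, t != ord0 -> s t = t).
  have -> : s = 1%g.
    apply/permP => l; rewrite perm1; have [->|/s1 //] := eqVneq l ord0.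
    by apply/eqP; apply: contraT => s0; have /perm_inj e := s1 _ s0; rewrite e eqxx in s0.
  exists (fun x => \prod_(l | l != ord0) \tr (Y l x)), (Y ord0); split=> //.
    by apply: trace_fun_prod => l; apply: trace_fun_A_monomial.
  move=> x m; rewrite cycle_sum1 (bigD1 ord0) //= mulrC; congr (_ * _).
  by apply: eq_bigr => l /negPf ->.
move=> /existsNP [t /not_implyP [t0 /eqP st]].
set u := s^-1%g t.
pose Y' l x := if l == t then 1 else if l == u then Y l x * Y t x else Y l x.
have [||phi [y [phiA ymon E]]] := IH (s * tperm t (s t))%g Y'.
- rewrite -ltnS; apply: leq_trans sN; rewrite ltnS; apply: proper_card; apply/properP; split.
    apply/subsetP => l; rewrite !inE permM; apply: contra => /eqP sl.
    rewrite sl tpermD //; apply: contra st => /eqP tl; first by rewrite tl sl.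
    by rewrite -(inj_eq (@perm_inj _ s)) tl sl.
  by exists t; rewrite ?inE // permM tpermR eqxx.
- move=> l; rewrite /Y'; case: (l == t); first exact: A_monomial_const.
  by case: (l == u) => //; apply: A_monomial_mul.
(* The factor [n%:R^-1] cancels the trace of the identity put in slot [t]. *)
exists (fun x => n%:R^-1 * phi x), y; split=> //.
  by apply: tf_mul => //; constructor.
move=> x m; rewrite -mulrA -E.
have nn0 : (n%:R : F) != 0 by move/pcharf0P: ch0 => ->; rewrite -lt0n.
apply: (mulfI nn0); rewrite mulrA mulfV // mul1r mulr_natl (cycle_sum_merge _ st).
apply: eq_bigr => p _; apply: eq_bigr => l _; congr (fun_of_matrix _ _ _).
rewrite /Y' -/u; case: (eqVneq l t) => [->|lt]; first by rewrite (negPf t0).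
rewrite (negPf t0); case: (eqVneq l u) => // lu.
by case: (l == ord0) => //; rewrite mulrA.
Qed.

(* Slot [0] holds the matrix paired with [Psi] under the trace. *)
Definition cons_slot d (m0 : M) (m : 'I_d -> M) (l : 'I_d.+1) : M :=
  if unlift ord0 l is Some j then m j else m0.

(** By cyclicity each generator gives a cycle sum over [s^-1] whose slots hold a matrix followed by
    its coefficient [a l]; the cycle of slot 0 supplies the matrix factor. *)
Lemma twisted_span_mixed d (i : 'I_d -> 'I_k) T : twisted_span A T ->
  exists2 h : vars -> M, mixed_A_trace_poly A h &
    forall x m, \tr (T * kron (cons_slot m (fun l => x (i l)))) = \tr (m * h x).
Proof.
elim=> [|c a s X aA _ [h hA hE]].
  by exists (fun=> 0); [exact: mixed0|move=> x m; rewrite mul0r mulr0 !mxtrace0].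
pose Y l (x : vars) := if unlift ord0 l is Some j then x (i j) * a l else a l.
have Ymon l : A_monomial (Y l).
  by rewrite /Y; case: unliftP => [j _|_]; [exact: A_monomial_var|exact: A_monomial_const].
have [phi [y [phiA [w [b [wA bA yE]]] E]]] := cycle_sum_mixed (s^-1)%g Ymon.
exists (fun x => c *: (phi x *: (word_eval w x * b)) + h x).
  by apply: mt_add => //; apply: mixed_scale; apply: mt_term.
move=> x m; rewrite mulrDl !mulrDr !mxtraceD hE; congr (_ + _).
rewrite -!mulmxE -scalemxAl -!scalemxAr !mxtraceZ; congr (_ * _).
rewrite mxtrace_mulC mulmxA !mulmxE kronM mxtrace_kron_permop -yE -E.
apply: eq_bigr => p _; apply: eq_bigr => l _; congr (fun_of_matrix _ _ _).
by rewrite /cons_slot /Y; case: unliftP => [j ->|->]; rewrite ?eqxx.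
Qed.

(** Equivariance of [Psi] makes its trace pairing with [m0] invariant under simultaneous
    conjugation. Decomposable tensors span, so [T] commutes with the powers of [g] and lies in the
    twisted span. *)
Lemma equivariant_multilinear_mixed d (i : 'I_d -> 'I_k) (Psi : ('I_d -> M) -> M) T :
  (forall m0 m, \tr (m0 * Psi m) = \tr (T * kron (cons_slot m0 m))) ->
  (forall g : M, g \in unitmx -> (forall a, a \in A -> g * a = a * g) ->
     forall m, Psi (fun l => g * m l * invmx g) = g * Psi m * invmx g) ->
  mixed_A_trace_poly A (fun x => Psi (fun l => x (i l))).
Proof.
move=> PsiT Psig.
have TT : twisted_span A T.
  apply: twisted_span_double_centralizer => // g gU gA.
  have gV : invmx g * g = 1 by exact: mulVmx.
  pose G := kron (fun _ : 'I_d.+1 => g); pose H := kron (fun _ : 'I_d.+1 => invmx g).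
  have GH : G * H = 1 by rewrite kronM -(kron1 n d.+1 F); apply: eq_kron => l; exact: mulmxV.
  have inv m : \tr (T * (G * kron m * H)) = \tr (T * kron m).
    have mE (m' : 'I_d.+1 -> M) : \tr (T * kron m') =
        \tr (m' ord0 * Psi (fun l => m' (lift ord0 l))).
      rewrite PsiT; congr (\tr (_ * _)); apply: eq_kron => l.
      by rewrite /cons_slot; case: unliftP => [j ->|->].
    rewrite !kronM !mE Psig // -!mulrA [invmx g * (g * _)]mulrA gV mul1r.
    by rewrite -mulmxE mxtrace_mulC !mulmxE -!mulrA gV mulr1.
  suff e : H * T * G = T by rewrite -[X in _ * X = _]e -/G !mulrA GH mul1r.
  apply/eqP; rewrite -subr_eq0; apply/eqP; apply: mxtrace_mul_eq0 => Z.
  rewrite (ffun_mxP Z) ffun_mx_delta_sum mulr_suml raddf_sum big1 //= => p _.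
  rewrite mulr_suml raddf_sum big1 //= => q _.
  rewrite -mulmxE -scalemxAl mxtraceZ mulmxE.
  move: (fun l : 'I_d.+1 => delta_mx (p l) (q l) : M) => m; have := inv m.
  rewrite mulrBr raddfB /= => im; rewrite [X in X - _](_ : _ = \tr (T * kron m)).
    by rewrite -!mulmxE [X in _ - X]mxtrace_mulC subrr mulr0.
  by rewrite -im -!mulmxE mxtrace_mulC -!mulmxA mxtrace_mulC -!mulmxA.
have [h hA hE] := twisted_span_mixed i TT.
apply: mixed_ext hA => x; apply/esym/eqP; rewrite -subr_eq0; apply/eqP.
by apply: mxtrace_mul_eq0 => m; rewrite mulrBr raddfB /= PsiT hE subrr.
Qed.

End Mixed.

(** * Polarization of polynomial maps *)

Section Polynomials.
Variables (F : fieldType) (n k : nat).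
Notation M := 'M[F]_n.
Notation vars := ('I_k -> M).
Notation coords := ('I_k * 'I_n * 'I_n)%type.

Definition coord (x : vars) (v : coords) : F := x v.1.1 v.1.2 v.2.

(** A polynomial as an explicit list of monomials, so that degrees are sizes and the top part is a
    filter. *)
Definition peval (L : seq (F * seq coords)) (x : vars) : F :=
  \sum_(cs <- L) cs.1 * \prod_(v <- cs.2) coord x v.

Lemma polyfun_peval f : polyfun f -> exists L, forall x, f x = peval L x.
Proof.
elim=> [c|l i j|g h _ [L gE] _ [L' hE]|g h _ [L gE] _ [L' hE]].
- by exists [:: (c, [::])] => x; rewrite /peval big_seq1 big_nil mulr1.
- by exists [:: (1, [:: (l, i, j)])] => x; rewrite /peval big_seq1 big_seq1 mul1r.
- by exists (L ++ L') => x; rewrite gE hE /peval big_cat.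
exists [seq (a.1 * b.1, a.2 ++ b.2) | a <- L, b <- L'] => x.
rewrite gE hE /peval big_allpairs_dep mulr_suml; apply: eq_bigr => a _.
rewrite mulr_sumr; apply: eq_bigr => b _ /=.
by rewrite big_cat /= mulrACA.
Qed.

Lemma coord_sum (T : finType) (P : {set T}) (u : T -> vars) v :
  coord (fun i => \sum_(j in P) u j i) v = \sum_(j in P) coord (u j) v.
Proof. by rewrite /coord summxE. Qed.

Lemma prod_seq_ord (T : Type) (s : seq T) : exists v : 'I_(size s) -> T,
  forall G : T -> F, \prod_(t <- s) G t = \prod_l G (v l).
Proof. by exists (tnth (in_tuple s)) => G; rewrite big_tnth. Qed.

(** [I] lists the monomials of degree exactly [d]; those of lower degree cancel in the alternating
    sum. Sharing [I] ties the polarization to the top-degree part. *)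
Lemma peval_polarization d L : all (fun cs => size cs.2 <= d)%N L ->
  exists I : seq (F * ('I_d -> coords)),
    (forall u : 'I_d -> vars,
      \sum_(J : {set 'I_d}) (-1) ^+ #|~: J| * peval L (fun i => \sum_(j in J) u j i) =
      \sum_(cv <- I) cv.1 * \sum_(s : 'S_d) \prod_l coord (u (s l)) (cv.2 l)) /\
    (forall x, peval [seq cs <- L | size cs.2 == d] x =
      \sum_(cv <- I) cv.1 * \prod_l coord x (cv.2 l)).
Proof.
elim: L => [_|[c s] L IH /= /andP [sd /IH [I [IE Ix]]]].
  exists [::]; split=> [u|x]; rewrite /peval ?big_nil // big1 // => J _.
  by rewrite big_nil mulr0.
have [v vE] := prod_seq_ord s.
have split_sum (u : 'I_d -> vars) :
    \sum_(J : {set 'I_d}) (-1) ^+ #|~: J| * peval ((c, s) :: L) (fun i => \sum_(j in J) u j i) =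
    c * (\sum_(J : {set 'I_d}) (-1) ^+ #|~: J| * \prod_l \sum_(j in J) coord (u j) (v l)) +
    \sum_(J : {set 'I_d}) (-1) ^+ #|~: J| * peval L (fun i => \sum_(j in J) u j i).
  rewrite mulr_sumr -big_split; apply: eq_bigr => J _ /=.
  rewrite /peval big_cons mulrDr mulrCA /= vE; congr (_ * (_ * _) + _).
  by apply: eq_bigr => l _; rewrite coord_sum.
case: eqVneq => [sE|sn].
  subst d; exists ((c, v) :: I); split=> [u|x]; rewrite ?split_sum big_cons.
    by rewrite IE ryser_perm.
  by rewrite -Ix /peval big_cons vE.
exists I; split=> [u|x]; last by rewrite -Ix.
by rewrite split_sum IE ryser_lt ?mulr0 ?add0r // ltn_neqAle sn.
Qed.

(** Multilinearity in all [d.+1] matrices, stated through the tensor that represents the form. *)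
Definition tensorial d (phi : M -> ('I_d -> M) -> F) :=
  exists T, forall m0 m, phi m0 m = \tr (T * kron (cons_slot m0 m)).

Lemma tensorial_scale d c (phi : M -> ('I_d -> M) -> F) :
  tensorial phi -> tensorial (fun m0 m => c * phi m0 m).
Proof.
by move=> [T TE]; exists (c *: T) => m0 m; rewrite TE -!mulmxE -scalemxAl mxtraceZ.
Qed.

Lemma tensorial_sum d (I : Type) (r : seq I) (phi : I -> M -> ('I_d -> M) -> F) :
  (forall i, tensorial (phi i)) -> tensorial (fun m0 m => \sum_(i <- r) phi i m0 m).
Proof.
move=> /choice [T TE]; exists (\sum_(i <- r) T i) => m0 m.
by rewrite mulr_suml raddf_sum; apply: eq_bigr => i _; rewrite TE.
Qed.

Lemma tensorial_ext d (phi psi : M -> ('I_d -> M) -> F) :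
  (forall m0 m, phi m0 m = psi m0 m) -> tensorial phi -> tensorial psi.
Proof. by move=> E [T TE]; exists T => m0 m; rewrite -E. Qed.

Lemma tensorial_prod d a b (al be : 'I_d -> 'I_n) :
  tensorial (fun m0 m => m0 a b * \prod_l m l (al l) (be l)).
Proof.
pose p0 (c : 'I_n) (ga : 'I_d -> 'I_n) : {ffun 'I_d.+1 -> 'I_n} :=
  [ffun l => if unlift ord0 l is Some j then ga j else c].
pose p := p0 a al; pose q := p0 b be.
exists (delta_mx (enum_rank q) (enum_rank p)) => m0 m.
set X := kron _.
have -> : \tr (delta_mx (enum_rank q) (enum_rank p) * X) = X (enum_rank p) (enum_rank q).
  rewrite /mxtrace (bigD1 (enum_rank q)) //= big1 => [|i iq]; last first.
    by rewrite mxE big1 // => j _; rewrite mxE (negPf iq) mul0r.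
  rewrite mxE (bigD1 (enum_rank p)) //= big1 => [|j jp].
    by rewrite mxE !eqxx mul1r !addr0.
  by rewrite mxE (negPf jp) andbF mul0r.
rewrite mxE !enum_rankK big_ord_recl /cons_slot !ffunE unlift_none; congr (_ * _).
by apply: eq_bigr => l _; rewrite !ffunE liftK.
Qed.

Definition slot_var (i : 'I_k) (y : M) : vars := fun j => if j == i then y else 0.

Lemma coord_slot_var i y v : coord (slot_var i y) v = (v.1.1 == i)%:R * y v.1.2 v.2.
Proof. by rewrite /coord /slot_var; case: eqP; rewrite ?mul1r ?mul0r ?mxE. Qed.

(** Full polarization without division: for [f] of degree at most [d], its diagonal is [d!] times
    the top-degree part. *)
Definition polar d (f : vars -> M) (u : 'I_d -> vars) : M :=
  \sum_(J : {set 'I_d}) (-1) ^+ #|~: J| *: f (fun i => \sum_(j in J) u j i).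

Lemma polarE d f u a b : polar f u a b =
  \sum_(J : {set 'I_d}) (-1) ^+ #|~: J| * f (fun i => \sum_(j in J) u j i) a b.
Proof. by rewrite summxE; apply: eq_bigr => J _; rewrite mxE. Qed.

Lemma polar_equivariant d f (g : M) (u : 'I_d -> vars) :
  (forall x, f (fun i => g * x i * invmx g) = g * f x * invmx g) ->
  polar f (fun l i => g * u l i * invmx g) = g * polar f u * invmx g.
Proof.
move=> fg; rewrite mulr_sumr mulr_suml; apply: eq_bigr => J _.
rewrite -[in RHS]mulmxE -scalemxAr -scalemxAl !mulmxE -fg; congr (_ *: f _).
by apply: funext => i; rewrite mulr_sumr mulr_suml.
Qed.

Section TopDegree.
Variables (d : nat) (f : vars -> M) (L : 'I_n * 'I_n -> seq (F * seq coords)).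
Hypothesis fL : forall a b x, f x a b = peval (L (a, b)) x.
Hypothesis Ld : forall ab, all (fun cs => size cs.2 <= d)%N (L ab).

Lemma polar_diag x a b :
  polar f (fun _ : 'I_d => x) a b = d`!%:R * peval [seq cs <- L (a, b) | size cs.2 == d] x.
Proof.
have [I [IE Ix]] := peval_polarization (Ld (a, b)).
rewrite polarE; under eq_bigr do rewrite fL.
rewrite IE Ix mulr_sumr; apply: eq_bigr => cv _.
by rewrite sumr_const card_Sn mulrnAr mulr_natl.
Qed.

(** Multilinear expansion of [x] as the sum of its components, so that each slot carries one matrix
    instead of a tuple. *)
Lemma polar_diag_slots x : polar f (fun _ : 'I_d => x) =
  \sum_(i : {ffun 'I_d -> 'I_k}) polar f (fun l => slot_var (i l) (x (i l))).
Proof.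
apply/matrixP => a b; rewrite [RHS]summxE.
have [I [IE _]] := peval_polarization (Ld (a, b)).
have pE u : polar f u a b = \sum_(cv <- I) cv.1 * \sum_(s : 'S_d) \prod_l coord (u (s l)) (cv.2 l).
  by rewrite polarE -IE; apply: eq_bigr => J _; rewrite fL.
rewrite pE; under [RHS]eq_bigr do rewrite pE.
rewrite exchange_big; apply: eq_bigr => cv _ /=.
rewrite -mulr_sumr exchange_big; congr (_ * _); apply: eq_bigr => s _ /=.
transitivity (\prod_l \sum_i coord (slot_var i (x i)) (cv.2 (s^-1%g l))).
  rewrite (reindex_inj (@perm_inj _ s^-1%g)) /=; apply: eq_bigr => l _.
  rewrite (bigD1 (cv.2 (s^-1%g l)).1.1) //= coord_slot_var eqxx mul1r.
  by rewrite big1 ?addr0 // => i ne; rewrite coord_slot_var eq_sym (negPf ne) mul0r.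
rewrite bigA_distr_bigA; apply: eq_bigr => i _.
rewrite (reindex_inj (@perm_inj _ s)) /=; apply: eq_bigr => l _.
by rewrite permK.
Qed.

Lemma polar_tensorial (i : 'I_d -> 'I_k) :
  tensorial (fun m0 m => \tr (m0 * polar f (fun l => slot_var (i l) (m l)))).
Proof.
apply: (@tensorial_ext _ (fun m0 m => \sum_a \sum_b
  m0 a b * polar f (fun l => slot_var (i l) (m l)) b a)) => [m0 m|].
  by apply: eq_bigr => a _; rewrite mxE.
apply: tensorial_sum => a; apply: tensorial_sum => b.
have [I [IE _]] := peval_polarization (Ld (b, a)).
(* The Kronecker symbols keep the terms in which slot [l] holds the variable that its coordinate
   reads. *)
apply: (@tensorial_ext _ (fun m0 m => \sum_(cv <- I) \sum_(s : 'S_d)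
  (cv.1 * \prod_l ((cv.2 (s^-1%g l)).1.1 == i l)%:R) *
  (m0 a b * \prod_l m l (cv.2 (s^-1%g l)).1.2 (cv.2 (s^-1%g l)).2))) => [m0 m|].
  rewrite polarE; under [in RHS]eq_bigr do rewrite fL.
  rewrite IE mulr_sumr; apply: eq_bigr => cv _.
  rewrite !mulr_sumr; apply: eq_bigr => s _.
  rewrite [RHS]mulrCA -!mulrA; congr (_ * _); rewrite [LHS]mulrCA -big_split; congr (_ * _).
  rewrite [RHS](reindex_inj (@perm_inj _ s^-1%g)) /=; apply: eq_bigr => l _.
  by rewrite coord_slot_var permKV.
apply: tensorial_sum => cv; apply: tensorial_sum => s.
exact/tensorial_scale/tensorial_prod.
Qed.

End TopDegree.

Variable A : {pred M}.
Hypotheses (ch0 : [pchar F] =i pred0) (n0 : (0 < n)%N) (uA : is_unital_subalgebra A).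
Hypothesis ssA : semisimple_alg A.

Definition equivariant (f : vars -> M) : Prop :=
  forall g : M, g \in unitmx -> (forall a, a \in A -> g * a = a * g) ->
    forall x, f (fun i => g * x i * invmx g) = g * f x * invmx g.

Lemma polar_diag_mixed d (f : vars -> M) (L : 'I_n * 'I_n -> seq (F * seq coords)) :
  (forall a b x, f x a b = peval (L (a, b)) x) ->
  (forall ab, all (fun cs => size cs.2 <= d)%N (L ab)) ->
  equivariant f -> mixed_A_trace_poly A (fun x => polar f (fun _ : 'I_d => x)).
Proof.
move=> fL Ld fA.
apply: (mixed_ext (fun x => esym (polar_diag_slots fL Ld x))).
apply: (mixed_sum uA) => i.
have [T TE] := polar_tensorial fL Ld i.
apply: (equivariant_multilinear_mixed ch0 n0 uA ssA i
  (Psi := fun m => polar f (fun l => slot_var (i l) (m l))) TE) => g gU gA m.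
rewrite -(polar_equivariant _ (fA g gU gA)); congr polar.
apply: funext => l; apply: funext => j; rewrite /slot_var.
by case: eqP; rewrite ?mulr0 ?mul0r.
Qed.

(* Strip the top-degree part, which polarization recovers equivariantly. *)
Lemma equivariant_peval_mixed d (f : vars -> M) (L : 'I_n * 'I_n -> seq (F * seq coords)) :
  (forall a b x, f x a b = peval (L (a, b)) x) ->
  (forall ab, all (fun cs => size cs.2 < d)%N (L ab)) ->
  equivariant f -> mixed_A_trace_poly A f.
Proof.
elim: d f L => [|d IH] f L fL Ld fA.
  apply: mixed_ext (mixed0 _ uA) => x; apply/matrixP => a b; rewrite fL mxE /peval.
  by case: (L (a, b)) (Ld (a, b)) => //; rewrite big_nil.
have {}Ld ab : all (fun cs => size cs.2 <= d)%N (L ab) by exact: Ld.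
pose top x := (d`!%:R)^-1 *: polar f (fun _ : 'I_d => x).
have topA : mixed_A_trace_poly A top by apply/mixed_scale/(polar_diag_mixed fL Ld fA).
have topE x a b : top x a b = peval [seq cs <- L (a, b) | size cs.2 == d] x.
  rewrite mxE (polar_diag fL Ld) mulrA mulVf ?mul1r //.
  by move/pcharf0P: ch0 => ->; rewrite -lt0n fact_gt0.
have top_equiv : equivariant top.
  move=> g gU gA x; rewrite /top (polar_equivariant _ (fA g gU gA)).
  by rewrite -!mulmxE -scalemxAr -scalemxAl.
apply: (@mixed_ext _ _ _ _ (fun x => (f x - top x) + top x)) => [x|]; first by rewrite subrK.
apply: mt_add => //.
(* Subtracting [top] removes exactly the monomials of degree [d], and equivariance survives. *)
apply: (IH _ (fun ab => [seq cs <- L ab | (size cs.2 < d)%N])).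
- move=> a b x; rewrite mxE [X in _ + X]mxE topE fL /peval !big_filter.
  rewrite (bigID (fun cs : F * seq coords => size cs.2 == d)) /= [X in X - _]addrC addrK.
  rewrite big_seq_cond [RHS]big_seq_cond; apply: eq_bigl => cs.
  have [csL|//] := boolP (cs \in L (a, b)).
  by rewrite ltn_neqAle (allP (Ld (a, b)) _ csL) andbT.
- by move=> ab; exact: filter_all.
- by move=> g gU gA x; rewrite fA // top_equiv // mulrBr mulrBl.
Qed.

End Polynomials.

Theorem theorem5p10 (F : fieldType) (n k : nat) (A : {pred 'M[F]_n})
  (f : ('I_k -> 'M[F]_n) -> 'M[F]_n) :
  [pchar F] =i pred0 ->
  is_unital_subalgebra A ->
  semisimple_alg A ->
  polynomial_map f ->
  (forall g : 'M[F]_n, g \in unitmx -> (forall a, a \in A -> g * a = a * g) ->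
     forall x : 'I_k -> 'M[F]_n,
       f (fun i => g * x i * invmx g) = g * f x * invmx g) ->
  exists h : ('I_k -> 'M[F]_n) -> 'M[F]_n,
    mixed_A_trace_poly A h /\ forall x, f x = h x.
Proof.
(* The case [n = 0] is separate because merging cycles divides by [n]. *)
move=> ch0 uA ssA fpol fA; have [n0|n0] := posnP n.
  exists (fun=> 0); split; first exact: mixed0.
  by move=> x; apply/matrixP => i; have := ltn_ord i; rewrite {2}n0.
exists f; split=> //.
have /choice [L fL] : forall ab : 'I_n * 'I_n,
    exists L : seq (F * seq ('I_k * 'I_n * 'I_n)), forall x, f x ab.1 ab.2 = peval L x.
  by move=> ab; apply/polyfun_peval/fpol.
pose d := \max_ab \max_(cs <- L ab) size cs.2.
apply: (@equivariant_peval_mixed _ _ _ A ch0 n0 uA ssA d.+1 f L) => // [a b x|ab].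
  by rewrite -fL.
apply/allP => cs csL; rewrite ltnS.
apply: leq_trans (leq_bigmax_cond (F := fun ab => \max_(cs <- L ab) size cs.2) ab isT).
exact: (leq_bigmax_seq (F := fun cs : F * seq ('I_k * 'I_n * 'I_n) => size cs.2) cs csL isT).
Qed.
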